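(* Let $n\in\mathbb N$ and let $S\subset\mathbb R^n$ be a nondegenerate $n$-dimensional simplex. If $S\subset B_n$, then $\alpha(B_n;S)\ge n$. Moreover (for $S\subset B_n$), the equality $\alpha(B_n;S)=n$ holds if and only if $S$ is a regular simplex inscribed into $B_n$.
   Context: $B_n=\{x\in\mathbb R^n:\|x\|\le 1\}$ is the closed Euclidean unit ball. For a nondegenerate simplex $S\subset\mathbb R^n$, $\tau S$ denotes the image of $S$ under the homothety with center at the center of gravity of $S$ and ratio $\tau$. For a convex body $C\subset\mathbb R^n$, $\alpha(C;S)$ is the minimal $\tau>0$ such that $C$ is contained in a translate of $\tau S$. A simplex is inscribed into a ball if all of its vertices lie on the boundary sphere of the ball; a simplex is regular if all its edges have equal length. *)

(* Defs.v *)
From HB Require Import structures.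
From mathcomp Require Import all_boot all_order all_algebra.
From mathcomp Require Import all_classical all_reals.

Set Implicit Arguments.
Unset Strict Implicit.
Unset Printing Implicit Defensive.

Import Order.TTheory GRing.Theory Num.Theory.
Local Open Scope classical_set_scope.
Local Open Scope ring_scope.

(* MathComp-Analysis equips ['rV[R]_n] with the sup norm, so the Euclidean
   norm is defined here. *)
Definition enorm (R : realType) (n : nat) (x : 'rV[R]_n) : R :=
  Num.sqrt (\sum_(i < n) x 0 i ^+ 2).

Definition closed_eball (R : realType) (n : nat) (c : 'rV[R]_n) (r : R) :
    set 'rV[R]_n :=
  [set x | enorm (x - c) <= r].

Definition esphere (R : realType) (n : nat) (c : 'rV[R]_n) (r : R) :
    set 'rV[R]_n :=
  [set x | enorm (x - c) = r].

Definition unit_eball (R : realType) (n : nat) : set 'rV[R]_n :=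
  closed_eball 0 1.
Arguments unit_eball R n _ : clear implicits.

(* A simplex is represented by the family of its [n + 1] vertices. *)
Definition nondegenerate_simplex (R : realType) (n : nat)
    (v : 'I_n.+1 -> 'rV[R]_n) : Prop :=
  row_free (\matrix_(i < n) (v (lift ord0 i) - v ord0)).

Definition simplex (R : realType) (n : nat) (v : 'I_n.+1 -> 'rV[R]_n) :
    set 'rV[R]_n :=
  [set x | exists w : 'I_n.+1 -> R,
     [/\ forall i, 0 <= w i, \sum_i w i = 1 & x = \sum_i w i *: v i]].

(* The center of gravity of a simplex is the mean of its vertices. *)
Definition centroid (R : realType) (n : nat) (v : 'I_n.+1 -> 'rV[R]_n) :
    'rV[R]_n :=
  n.+1%:R^-1 *: \sum_i v i.

Definition homothety (R : realType) (n : nat) (c : 'rV[R]_n) (tau : R)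
    (x : 'rV[R]_n) : 'rV[R]_n :=
  c + tau *: (x - c).

Definition dilated_simplex (R : realType) (n : nat) (tau : R)
    (v : 'I_n.+1 -> 'rV[R]_n) : set 'rV[R]_n :=
  homothety (centroid v) tau @` simplex v.

Definition absorbing_ratios (R : realType) (n : nat) (C : set 'rV[R]_n)
    (v : 'I_n.+1 -> 'rV[R]_n) : set R :=
  [set tau | 0 < tau /\
     exists t : 'rV[R]_n, C `<=` [set t + y | y in dilated_simplex tau v]].

(* The least element of [absorbing_ratios C v], and [0] (never an admissible
   ratio) if there is no least element. *)
Definition alpha (R : realType) (n : nat) (C : set 'rV[R]_n)
    (v : 'I_n.+1 -> 'rV[R]_n) : R :=
  xget 0 (absorbing_ratios C v `&` lbound (absorbing_ratios C v)).

Definition regular_simplex (R : realType) (n : nat)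
    (v : 'I_n.+1 -> 'rV[R]_n) : Prop :=
  forall i j k l : 'I_n.+1, i != j -> k != l ->
    enorm (v i - v j) = enorm (v k - v l).

Definition inscribed_simplex (R : realType) (n : nat)
    (v : 'I_n.+1 -> 'rV[R]_n) (c : 'rV[R]_n) (r : R) : Prop :=
  forall i, esphere c r (v i).

(* Main.v *)
Require Import Defs.
From mathcomp Require Import all_boot all_order all_algebra.
From mathcomp Require Import all_classical all_reals.
From mathcomp Require Import ring lra.
Import Order.TTheory GRing.Theory Num.Theory.
Local Open Scope classical_set_scope.
Local Open Scope ring_scope.

(** Let [a j] be the gradient of the [j]-th barycentric coordinate of the
    simplex. A translate of [tau S] is cut out by the inequalities
    [<a j, x - u> >= - tau / (n + 1)], so it contains the unit ball iff
    [|a j| + <a j, u> <= tau / (n + 1)] for all [j]. Since the [a j] sum to [0],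
    a suitable [u] exists iff [\sum_j |a j| <= tau]; hence
    [alpha (B_n; S) = \sum_j |a j|]. On the other hand [\sum_j <a j, v j> = n],
    and [<a j, v j> <= |a j|] because [|v j| <= 1]. Equality forces
    [a j = |a j| v j] with [|v j| = 1], and then
    [<v i, v j> = 1 - 1 / |a j|] for [i != j], which by symmetry does not depend
    on [i] and [j]. Conversely, if all [|v j| = 1] and all [<v i, v j>] with
    [i != j] equal [c], then [a j = v j / (1 - c)], which gives equality. *)

(** * Euclidean inner product and the equality case of Cauchy-Schwarz *)

Definition dot {R : realType} {n : nat} (x y : 'rV[R]_n) : R :=
  (x *m y^T) 0 0.

Section Dot.
Context {R : realType} {n : nat}.
Implicit Types (x y z : 'rV[R]_n) (k : R).

Lemma dotE x y : dot x y = \sum_i x 0 i * y 0 i.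
Proof. by rewrite /dot mxE; apply: eq_bigr => i _; rewrite mxE. Qed.

Lemma dotC x y : dot x y = dot y x.
Proof. by rewrite !dotE; apply: eq_bigr => i _; rewrite mulrC. Qed.

Lemma dotDr x y z : dot x (y + z) = dot x y + dot x z.
Proof. by rewrite /dot linearD mulmxDr mxE. Qed.

Lemma dotZr k x y : dot x (k *: y) = k * dot x y.
Proof. by rewrite /dot linearZ -scalemxAr mxE. Qed.

Lemma dotNr x y : dot x (- y) = - dot x y.
Proof. by rewrite -scaleN1r dotZr mulN1r. Qed.

Lemma dotBr x y z : dot x (y - z) = dot x y - dot x z.
Proof. by rewrite dotDr dotNr. Qed.

Lemma dotBl x y z : dot (x - y) z = dot x z - dot y z.
Proof. by rewrite dotC dotBr !(dotC z). Qed.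

Lemma dotZl k x y : dot (k *: x) y = k * dot x y.
Proof. by rewrite dotC dotZr dotC. Qed.

Lemma dot0r x : dot x 0 = 0.
Proof. by rewrite -(scale0r (0 : 'rV[R]_n)) dotZr mul0r. Qed.

Lemma dot_sumr (I : finType) x (F : I -> 'rV[R]_n) :
  dot x (\sum_i F i) = \sum_i dot x (F i).
Proof. exact: (big_morph (dot x) (dotDr x) (dot0r x)). Qed.

Lemma dot_suml (I : finType) x (F : I -> 'rV[R]_n) :
  dot (\sum_i F i) x = \sum_i dot (F i) x.
Proof. by rewrite dotC dot_sumr; apply: eq_bigr => i _; rewrite dotC. Qed.

Lemma dot_ge0 x : 0 <= dot x x.
Proof. by rewrite dotE sumr_ge0 // => i _; rewrite -expr2 sqr_ge0. Qed.

Lemma dot_eq0 x : (dot x x == 0) = (x == 0).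
Proof.
apply/idP/eqP => [|->]; last by rewrite dot0r.
rewrite dotE psumr_eq0 => [/allP x0|i _]; last by rewrite -expr2 sqr_ge0.
apply/rowP => i; have := x0 i (mem_index_enum i).
by rewrite -expr2 sqrf_eq0 mxE => /eqP.
Qed.

Lemma enormE x : enorm x = Num.sqrt (dot x x).
Proof.
by rewrite dotE /enorm; congr Num.sqrt; apply: eq_bigr => i _; rewrite expr2.
Qed.

Lemma enorm_ge0 x : 0 <= enorm x.
Proof. exact: sqrtr_ge0. Qed.

Lemma sqr_enorm x : enorm x ^+ 2 = dot x x.
Proof. by rewrite enormE sqr_sqrtr // dot_ge0. Qed.

Lemma enorm_eq0 x : (enorm x == 0) = (x == 0).
Proof. by rewrite -sqrf_eq0 sqr_enorm dot_eq0. Qed.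

Lemma enormZ k x : enorm (k *: x) = `|k| * enorm x.
Proof.
by rewrite !enormE dotZl dotZr mulrA -expr2 sqrtrM ?sqr_ge0// sqrtr_sqr.
Qed.

Lemma sqr_enormB x y : enorm (x - y) ^+ 2 = dot x x - 2 * dot x y + dot y y.
Proof. by rewrite sqr_enorm dotBl !dotBr (dotC y x); ring. Qed.

(** Both the Cauchy-Schwarz bound and its equality case are read off from this square; scaling [y]
    by [enorm x] instead of normalizing [x] avoids a division. *)
Lemma sqr_enorm_deviation x y :
  enorm (x - enorm x *: y) ^+ 2 =
  enorm x * (enorm x - 2 * dot x y) + (enorm x * enorm y) ^+ 2.
Proof.
by rewrite sqr_enormB exprMn !sqr_enorm !dotZr dotZl -[dot x x]sqr_enorm; ring.
Qed.

Lemma dot_le_enorm x y : enorm y <= 1 -> dot x y <= enorm x.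
Proof.
move=> y1; have := sqr_ge0 (enorm (x - enorm x *: y)).
rewrite sqr_enorm_deviation.
have [x0|x0] := eqVneq (enorm x) 0.
  move: x0 => /eqP; rewrite enorm_eq0 => /eqP ->.
  by rewrite dotC dot0r enorm_ge0.
have xp : 0 < enorm x by rewrite lt0r x0 enorm_ge0.
have xy : enorm x * enorm y ^+ 2 <= enorm x.
  by rewrite ler_piMr ?expr_le1 ?enorm_ge0// ltW.
rewrite exprMn [enorm x ^+ 2]expr2 -mulrA -mulrDr pmulr_rge0//; lra.
Qed.

Lemma dot_eq_enorm x y : enorm y <= 1 -> dot x y = enorm x ->
  x = enorm x *: y.
Proof.
move=> y1 xy; apply/eqP; rewrite -subr_eq0 -enorm_eq0 -sqrf_eq0.
rewrite eq_le sqr_ge0 andbT sqr_enorm_deviation xy.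
have : (enorm x * enorm y) ^+ 2 <= enorm x ^+ 2.
  by rewrite ler_sqr ?nnegrE ?mulr_ge0 ?enorm_ge0// ler_piMr ?enorm_ge0.
by rewrite [enorm x ^+ 2]expr2; lra.
Qed.

Lemma exists_dot_eq_Nenorm x : exists2 y, enorm y <= 1 & dot x y = - enorm x.
Proof.
(* For [x = 0] the convention [0^-1 = 0] makes this the zero vector. *)
exists (- (enorm x)^-1 *: x).
  rewrite enormZ normrN ger0_norm ?invr_ge0 ?enorm_ge0//.
  by have [->|x0] := eqVneq (enorm x) 0; rewrite ?mulr0// mulVf.
rewrite dotZr -sqr_enorm.
by have [->|x0] := eqVneq (enorm x) 0; [rewrite expr2 !mulr0 oppr0|field].
Qed.

End Dot.

(** * Gradients of the barycentric coordinates *)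

Section BarycentricGradients.
Context {R : realType} {n : nat}.
Implicit Types (v a : 'I_n.+1 -> 'rV[R]_n).

(** Only differences of vertices are paired with [a j], since a gradient forgets the additive
    constant of its affine coordinate. *)
Definition barycentric_gradients v a : Prop :=
  [/\ \sum_j a j = 0,
      forall i j k, dot (a j) (v i - v k) = (i == j)%:R - (k == j)%:R
    & forall y, y = \sum_j dot (a j) y *: v j].

(** The columns of the inverse edge matrix serve the vertices other than [v ord0]; the gradient for
    [v ord0] is then forced by the zero sum. *)
Lemma exists_barycentric_gradients v :
  nondegenerate_simplex v -> exists a, barycentric_gradients v a.
Proof.
rewrite /nondegenerate_simplex row_free_unit; set M := (X in X \in _) => Mu.
pose c k := (col k (invmx M))^T.
pose a j := if unlift ord0 j is Some k then c k else - \sum_k c k.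
have a0 : a ord0 = - \sum_k c k by rewrite /a unlift_none.
have aS k : a (lift ord0 k) = c k by rewrite /a liftK.
have sum_a : \sum_j a j = 0.
  by rewrite big_ord_recl (eq_bigr c) // a0 addNr.
have dot_c k y : dot (c k) y = (y *m invmx M) 0 k.
  rewrite dotC /dot trmxK !mxE.
  by apply: eq_bigr => i _; rewrite mxE.
have dot_cM k i : dot (c k) (v (lift ord0 i) - v ord0) = (i == k)%:R.
  have -> : v (lift ord0 i) - v ord0 = row i M by rewrite rowK.
  by rewrite dot_c -row_mul mulmxV// !mxE.
have dot_v0 i j : dot (a j) (v i - v ord0) = (i == j)%:R - (ord0 == j)%:R.
  have [i' ->|->] := unliftP ord0 i; last by rewrite !subrr dot0r.
  have [j' ->|->] := unliftP ord0 j.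
    by rewrite aS dot_cM (inj_eq (@lift_inj _ _)) (negPf (neq_lift _ _)) subr0.
  rewrite a0 -scaleN1r dotZl dot_suml.
  under eq_bigr do rewrite dot_cM.
  rewrite (bigD1 i')//= eqxx big1 ?addr0 => [|k /negPf]; last first.
    by rewrite eq_sym => ->.
  by rewrite mulr1 sub0r.
exists a; split=> // [i j k|y].
  have -> : v i - v k = (v i - v ord0) - (v k - v ord0).
    by rewrite opprB addrA subrK.
  by rewrite dotBr !dot_v0; ring.
have -> : \sum_j dot (a j) y *: v j = \sum_j dot (a j) y *: (v j - v ord0).
  under [RHS]eq_bigr do rewrite scalerBr.
  by rewrite sumrB -scaler_suml -dot_suml sum_a dotC dot0r scale0r subr0.
rewrite big_ord_recl subrr scaler0 add0r.
rewrite -[LHS]mulmx1 -(mulVmx Mu) mulmxA mulmx_sum_row.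
by apply: eq_bigr => k _; rewrite aS dot_c rowK.
Qed.

Context {v a : 'I_n.+1 -> 'rV[R]_n}.
Hypothesis av : barycentric_gradients v a.

Lemma sum_dot_gradient y : \sum_j dot (a j) y = 0.
Proof. by case: av => sa _ _; rewrite -dot_suml sa dotC dot0r. Qed.

(** Zero total weight allows recentring at [v j]; each [i] other than [j] then contributes [- w i],
    and these add up to [w j]. *)
Lemma dot_gradient_comb (w : 'I_n.+1 -> R) j :
  \sum_i w i = 0 -> dot (a j) (\sum_i w i *: v i) = w j.
Proof.
case: av => _ avd _ w0.
have -> : \sum_i w i *: v i = \sum_i w i *: (v i - v j).
  under [in RHS]eq_bigr do rewrite scalerBr.
  by rewrite sumrB -scaler_suml w0 scale0r subr0.
rewrite dot_sumr.
under eq_bigr do rewrite dotZr avd eqxx mulrBr mulr1.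
rewrite sumrB w0 subr0 (bigD1 j)//= eqxx mulr1 big1 ?addr0// => i /negPf ->.
by rewrite mulr0.
Qed.

Lemma sum_dot_gradient_vertex : \sum_j dot (a j) (v j) = n%:R.
Proof.
case: av => _ avd _.
transitivity (\sum_j dot (a j) (v j - v ord0)).
  under [RHS]eq_bigr do rewrite dotBr.
  by rewrite sumrB sum_dot_gradient subr0.
under eq_bigr do rewrite avd eqxx.
rewrite big_ord_recl subrr add0r.
under eq_bigr do rewrite subr0.
by rewrite sumr_const card_ord.
Qed.

(** The difference [x - a j] pairs equally with all vertices, and every vector combines the vertices
    with weights of sum zero, so this difference is orthogonal to everything. *)
Lemma gradient_unique j x :
  (forall i k, dot x (v i - v k) = (i == j)%:R - (k == j)%:R) -> x = a j.
Proof.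
case: av => _ avd avs xd.
have x_dot y : dot (x - a j) y = 0.
  rewrite (avs y) dot_sumr.
  under eq_bigr do rewrite dotZr.
  have d_const i : dot (x - a j) (v i) = dot (x - a j) (v j).
    by apply/eqP; rewrite -subr_eq0 -dotBr dotBl xd avd subrr.
  under eq_bigr do rewrite d_const.
  by rewrite -mulr_suml sum_dot_gradient mul0r.
by apply/eqP; rewrite -subr_eq0 -dot_eq0 x_dot.
Qed.

Lemma gradient_neq0 j : (0 < n)%N -> a j != 0.
Proof.
case: av => _ avd _ n0; apply/eqP => aj0.
have := avd j j (lift j (Ordinal n0)); rewrite aj0 dotC dot0r eqxx eq_sym.
by rewrite (negPf (neq_lift _ _)) subr0 => /esym/eqP; rewrite oner_eq0.
Qed.

(** The centroid has all barycentric coordinates [1 / (n + 1)], so dilation about it turns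
    [0 <= w j] into the bound [- tau / (n + 1)] on the displacement from the translated centroid. *)
Lemma mem_translated_dilate (tau : R) (t x : 'rV[R]_n) : 0 < tau ->
  [set t + y | y in dilated_simplex tau v] x <->
  forall j, - (tau / n.+1%:R) <= dot (a j) (x - (t + centroid v)).
Proof.
move=> tau0; case: (av) => _ _ avs.
have centroid_sum : centroid v = \sum_i n.+1%:R^-1 *: v i.
  by rewrite /centroid scaler_sumr.
have sum_inv : \sum_(i < n.+1) n.+1%:R^-1 = 1 :> R.
  by rewrite sumr_const card_ord -[LHS]mulr_natl mulfV// pnatr_eq0.
split=> [[_ [s [w [w0 w1 ->]] <-] <-] j|xd].
  rewrite /homothety addrA (addrC (_ + _)) addrK dotZr centroid_sum -sumrB.
  under eq_bigr do rewrite -scalerBl.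
  rewrite dot_gradient_comb ?sumrB ?w1 ?sum_inv ?subrr//.
  by rewrite mulrBr lerBrDr addrC subrr mulr_ge0// ltW.
pose z := x - (t + centroid v).
(* Solves [tau * (w j - 1 / (n + 1)) = dot (a j) z]: these are the barycentric coordinates of the
   preimage of [x]. *)
pose w j := tau^-1 * dot (a j) z + n.+1%:R^-1.
exists (centroid v + z); last by rewrite addrA addrC subrK.
exists (\sum_i w i *: v i).
  exists w; split=> // [j|].
    rewrite /w -(pmulr_rge0 _ tau0) mulrDr mulrA mulfV ?gt_eqF// mul1r.
    by rewrite -lerBlDr sub0r; exact: xd.
  by rewrite big_split/= -mulr_sumr sum_dot_gradient mulr0 add0r sum_inv.
rewrite /homothety; congr (_ + _).
under eq_bigr do rewrite scalerDl -scalerA.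
rewrite big_split/= -centroid_sum addrK -scaler_sumr -avs scalerA mulfV ?scale1r//.
by rewrite gt_eqF.
Qed.

(** * The unit ball inside translated dilates *)

Lemma absorbing_ratios_unit_eball (tau : R) : 0 < tau ->
  absorbing_ratios (unit_eball R n) v tau <-> \sum_j enorm (a j) <= tau.
Proof.
move=> tau0; have np : n.+1%:R != 0 :> R by rewrite pnatr_eq0.
have sum_mean (r : R) : \sum_(j < n.+1) r / n.+1%:R = r.
  by rewrite sumr_const card_ord -[LHS]mulr_natr divfK.
split=> [[_ [t Bt]]|a_tau].
  (* Summing over [j] eliminates the unknown translation. *)
  suff : \sum_j (enorm (a j) + dot (a j) (t + centroid v)) <=
         \sum_(j < n.+1) tau / n.+1%:R.
    by rewrite big_split/= sum_dot_gradient addr0 sum_mean.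
  apply: ler_sum => j _.
  have [y y1 ay] := exists_dot_eq_Nenorm (a j).
  have /Bt : unit_eball R n y by rewrite /unit_eball/closed_eball/= subr0.
  move=> /(mem_translated_dilate _ _ _ tau0) /(_ j).
  by rewrite dotBr ay -opprD lerN2.
split=> //; pose s := \sum_j enorm (a j).
(* Chosen so that [enorm (a j) + w j] is the same for all [j]; the zero sum makes a translation
   realize these values. *)
pose w j := s / n.+1%:R - enorm (a j).
have w0 : \sum_j w j = 0 by rewrite sumrB sum_mean subrr.
exists (\sum_j w j *: v j - centroid v) => x; rewrite /unit_eball/closed_eball/=.
rewrite subr0 => x1; apply/(mem_translated_dilate _ _ _ tau0) => j.
rewrite subrK dotBr (dot_gradient_comb _ _ w0) /w.
have := dot_le_enorm (a j) (- x); rewrite dotNr -scaleN1r enormZ normrN1 mul1r.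
move=> /(_ x1) ax.
have : s / n.+1%:R <= tau / n.+1%:R by rewrite ler_pM2r ?invr_gt0 ?ltr0n.
by move: (s / _) (tau / _) => p q; lra.
Qed.

(** The admissible ratios form a closed half-line starting at this positive sum, so [xget] returns
    its endpoint and not the default [0]. *)
Lemma alpha_unit_eball : 0 < \sum_j enorm (a j) ->
  alpha (unit_eball R n) v = \sum_j enorm (a j).
Proof.
move=> s0; rewrite /alpha; apply: xget_unique.
  split; first exact/absorbing_ratios_unit_eball.
  by move=> tau tauA; apply/absorbing_ratios_unit_eball => //; case: tauA.
move=> tau [tauA tau_le]; apply/le_anti/andP; split.
  by apply: tau_le; apply/absorbing_ratios_unit_eball.
by apply/absorbing_ratios_unit_eball => //; case: tauA.
Qed.

(** The left side of the equivalence is equality in each Cauchy-Schwarz bound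
    [dot (a j) (v j) <= enorm (a j)]. *)
Lemma regular_inscribedP : (0 < n)%N ->
  (forall i, enorm (v i) <= 1) ->
  (forall j, dot (a j) (v j) = enorm (a j)) <->
  regular_simplex v /\ inscribed_simplex v 0 1.
Proof.
move=> n0 v1; case: (av) => _ avd _.
have sq_edge i j : enorm (v i) = 1 -> enorm (v j) = 1 ->
    enorm (v i - v j) ^+ 2 = 2 - 2 * dot (v i) (v j).
  by move=> vi vj; rewrite sqr_enormB -!sqr_enorm vi vj; ring.
split=> [eq_av|[reg ins]].
  have ap j : enorm (a j) != 0 by rewrite enorm_eq0 gradient_neq0.
  have a_v j : a j = enorm (a j) *: v j by exact: dot_eq_enorm.
  have vn j : enorm (v j) = 1.
    apply: (mulfI (ap j)).
    by rewrite mulr1 [in RHS]a_v enormZ ger0_norm ?enorm_ge0.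
  have dvj i j : i != j -> enorm (a j) * (1 - dot (v i) (v j)) = 1.
    move=> ij; transitivity (dot (a j) (v j - v i)).
      by rewrite dotBr eq_av {3}a_v dotZl (dotC (v j)); ring.
    by rewrite avd eqxx (negPf ij) subr0.
  (* Both norms are the inverse of the same number [1 - dot (v i) (v j)]. *)
  have aC i j : enorm (a i) = enorm (a j).
    have [->//|ij] := eqVneq i j.
    have eij := dvj i j ij.
    have eji : enorm (a i) * (1 - dot (v i) (v j)) = 1.
      by rewrite dotC dvj// eq_sym.
    have d0 : 1 - dot (v i) (v j) != 0.
      by apply: contra_eq_neq eij => ->; rewrite mulr0 eq_sym oner_eq0.
    by apply: (mulIf d0); rewrite eij.
  split=> [i j k l ij kl|i]; last by rewrite /esphere/= subr0.
  apply/eqP; rewrite -(eqrXn2 (n := 2)) ?enorm_ge0// !sq_edge//.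
  have eij := dvj i j ij; have ekl := dvj k l kl; rewrite (aC l j) in ekl.
  have : 1 - dot (v i) (v j) = 1 - dot (v k) (v l).
    by apply: (mulfI (ap j)); rewrite eij.
  by move=> ?; apply/eqP; lra.
have vn j : enorm (v j) = 1 by have := ins j; rewrite /esphere/= subr0.
pose i0 : 'I_n.+1 := ord0; pose i1 : 'I_n.+1 := lift ord0 (Ordinal n0).
pose c := dot (v i0) (v i1).
(* The Gram matrix of the vertices: [1] on the diagonal, [c] off it. *)
have dotvv i j : dot (v i) (v j) = c + (i == j)%:R * (1 - c).
  have [->|ij] := eqVneq i j; first by rewrite -sqr_enorm vn /=; ring.
  have : enorm (v i - v j) ^+ 2 = enorm (v i0 - v i1) ^+ 2.
    by rewrite (reg i j i0 i1 ij (neq_lift _ _)).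
  by rewrite !sq_edge// /c mul0r; lra.
have c1 : 1 - c != 0.
  apply/eqP => c1.
  have vv : v i0 = v i1.
    apply/eqP; rewrite -subr_eq0 -enorm_eq0 -sqrf_eq0 sq_edge//.
    by apply/eqP; move: c1; rewrite /c; lra.
  have := avd i0 i0 i1; rewrite vv subrr dot0r eqxx eq_sym.
  by rewrite (negPf (neq_lift _ _)) subr0 => /esym/eqP; rewrite oner_eq0.
have c_gt0 : 0 < 1 - c.
  rewrite lt0r c1/=; have := sqr_ge0 (enorm (v i0 - v i1)).
  by rewrite sq_edge// -/c; lra.
(* By the Gram matrix the candidate has the right pairings with the edges, so uniqueness identifies
   it. *)
move=> j; have <- : (1 - c)^-1 *: v j = a j.
  apply: gradient_unique => i k; rewrite dotZl dotBr !dotvv ![j == _]eq_sym.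
  by field.
by rewrite dotZl enormZ vn -sqr_enorm vn expr1n ger0_norm// invr_ge0 ltW.
Qed.

End BarycentricGradients.

Lemma simplex_vertex {R : realType} {n : nat} (v : 'I_n.+1 -> 'rV[R]_n) i :
  simplex v (v i).
Proof.
exists (fun j => (j == i)%:R); split=> [j||].
- by rewrite ler0n.
- by rewrite (bigD1 i)//= eqxx big1 ?addr0// => j /negPf ->.
- rewrite (bigD1 i)//= eqxx scale1r big1 ?addr0// => j /negPf ->.
  by rewrite scale0r.
Qed.

Theorem theorem2 (R : realType) (n : nat) (hn : (0 < n)%N)
    (v : 'I_n.+1 -> 'rV[R]_n) (hv : nondegenerate_simplex v)
    (hS : simplex v `<=` unit_eball R n) :
  n%:R <= alpha (unit_eball R n) v /\
  (alpha (unit_eball R n) v = n%:R <-> regular_simplex v /\ inscribed_simplex v 0 1).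
Proof.
have v1 i : enorm (v i) <= 1.
  by have := hS _ (simplex_vertex v i); rewrite /unit_eball/closed_eball/= subr0.
have [a av] := exists_barycentric_gradients _ hv.
have av_le j : dot (a j) (v j) <= enorm (a j) by exact: dot_le_enorm.
have n_le : n%:R <= \sum_j enorm (a j).
  by rewrite -(sum_dot_gradient_vertex av); apply: ler_sum.
rewrite (alpha_unit_eball av); last by rewrite (lt_le_trans _ n_le)// ltr0n.
split=> //; rewrite -(regular_inscribedP av hn v1).
split=> [sum_eq j|eq_av]; last first.
  by rewrite -(sum_dot_gradient_vertex av); apply: eq_bigr => j _.
(* The gaps are nonnegative with zero sum, so each of them vanishes. *)
have /eqP : \sum_j (enorm (a j) - dot (a j) (v j)) = 0.
  by rewrite sumrB sum_eq (sum_dot_gradient_vertex av) subrr.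
rewrite psumr_eq0 => [/allP/(_ j (mem_index_enum j))|i _]; last first.
  by rewrite subr_ge0.
by rewrite subr_eq0 => /eqP.
Qed.
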